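(* Let $R=\bigoplus_{n\geq0}R_n$ be a graded $\mathbb Q$-algebra of finite type which is an integral domain with $\dim_{\mathbb Q}R_n<\infty$ for all $n$, and let $\mathscr R=\bigoplus_n\mathscr R_n$ be a graded subalgebra with each $\mathscr R_n$ a finitely generated $\mathbb Z$-module and $\mathscr R_n\otimes_{\mathbb Z}\mathbb Q=R_n$. For each $n$ let $\|\cdot\|_n$ be a norm on $R_n\otimes_{\mathbb Q}\mathbb R$ such that $\|ab\|_{n+n'}\leq\|a\|_n\|b\|_{n'}$ for $a\in\mathscr R_n$, $b\in\mathscr R_{n'}$. Let $X=\operatorname{Proj}(R)$, $d=\dim X$, and $\mathfrak S_X$ the set of closed subvarieties of $X$. For $Y\in\mathfrak S_X$ with homogeneous prime ideal $P=\bigoplus P_n$, set $R_{Y,n}=R_n/P_n$, $\mathscr R_{Y,n}=\mathscr R_n/(P_n\cap\mathscr R_n)$, and let $\|\cdot\|^{\mathrm{quot}}_{Y,n}$ be the quotient norm on $R_{Y,n}\otimes\mathbb R$ induced by $\|\cdot\|_n$. Let $\upsilon:\mathfrak S_X\to\mathbb R_{>0}$ be a map such that for every $Y\in\mathfrak S_X$ there are $n(Y)\geq1$ and $s_Y\in\mathscr R_{Y,n(Y)}\setminus\{0\}$ with $\|s_Y\|^{\mathrm{quot}}_{Y,n(Y)}\leq\upsilon(Y)^{n(Y)}$. Then there are $B>0$ and a finite subset $S\subseteq\mathfrak S_X$ such that for all $n\geq1$, $\lambda_{\mathbb Q}(\mathscr R_n,\|\cdot\|_n)\leq B\,n^{d(d+1)/2}\big(\max_{Y\in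 S}\upsilon(Y)\big)^n.$
   Context: A closed subvariety means a closed, reduced and irreducible subscheme over $\mathbb Q$. For a finitely generated $\mathbb Z$-module $\mathscr M$ with a norm $\|\cdot\|$ on $\mathscr M\otimes_{\mathbb Z}\mathbb R$: if $\mathscr M$ is torsion, $\lambda_{\mathbb Q}(\mathscr M,\|\cdot\|)=0$; otherwise $\lambda_{\mathbb Q}(\mathscr M,\|\cdot\|)$ is the infimum of $\lambda\geq0$ such that there is a $\mathbb Q$-basis $e_1,\ldots,e_r$ of $\mathscr M\otimes\mathbb Q$ contained in $\mathscr M$ with $\|e_i\|\leq\lambda$ for all $i$. *)

(* Defs.v *)
From HB Require Import structures.
From mathcomp Require Import all_boot all_order all_algebra.
From mathcomp Require Import all_classical all_reals all_analysis.
Import Order.TTheory GRing.Theory Num.Theory.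
Import numFieldNormedType.Exports.
Set Implicit Arguments. Unset Strict Implicit. Unset Printing Implicit Defensive.
Local Open Scope classical_set_scope.
Local Open Scope ring_scope.

Section GradedDefs.
Variable A : comAlgType rat.

Definition Qspan (S : A -> Prop) (x : A) : Prop :=
  exists k (e : 'I_k -> A) (q : 'I_k -> rat),
    (forall i, S (e i)) /\ x = \sum_(i < k) q i *: e i.

Definition Qfree k (e : 'I_k -> A) : Prop :=
  forall q : 'I_k -> rat, \sum_(i < k) q i *: e i = 0 -> forall i, q i = 0.

Definition Qsubspace (S : A -> Prop) : Prop :=
  [/\ S 0, (forall x y, S x -> S y -> S (x + y)) & (forall (q : rat) x, S x -> S (q *: x))].

Definition is_grading (G : nat -> A -> Prop) : Prop :=
  [/\ (forall n, Qsubspace (G n)), G 0%N 1,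
      (forall n m a b, G n a -> G m b -> G (n + m)%N (a * b)),
      (forall x, exists k (c : 'I_k -> A), (forall i : 'I_k, G i (c i)) /\ x = \sum_(i < k) c i)
    & (forall k (c : 'I_k -> A), (forall i : 'I_k, G i (c i)) ->
          \sum_(i < k) c i = 0 -> forall i, c i = 0)].

Definition Qsubalg (S : A -> Prop) : Prop :=
  [/\ Qsubspace S, S 1 & (forall x y, S x -> S y -> S (x * y))].

Definition finite_type : Prop :=
  exists k (g : 'I_k -> A), forall S, Qsubalg S -> (forall i, S (g i)) -> forall x, S x.

Definition Qfindim (S : A -> Prop) : Prop :=
  exists k (e : 'I_k -> A), (forall i, S (e i)) /\
    forall x, S x -> Qspan (fun y => exists i, y = e i) x.

Definition Zfingen (S : A -> Prop) : Prop :=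
  exists k (g : 'I_k -> A), (forall i, S (g i)) /\
    forall x, S x -> exists z : 'I_k -> int, x = \sum_(i < k) g i *~ z i.

Definition is_integral_structure (G M : nat -> A -> Prop) : Prop :=
  [/\ (forall n, M n 0 /\ forall x y, M n x -> M n y -> M n (x - y)),
      (forall n x, M n x -> G n x),
      M 0%N 1 /\ (forall n m a b, M n a -> M m b -> M (n + m)%N (a * b)),
      (forall n, Zfingen (M n))
    & (forall n x, G n x -> Qspan (M n) x)].

Definition hom_prime (G : nat -> A -> Prop) (P : A -> Prop) : Prop :=
  [/\ P 0 /\ (forall x y, P x -> P y -> P (x + y)), (forall r x, P x -> P (r * x)), ~ P 1,
      (forall a b, P (a * b) -> P a \/ P b)
    & (forall k (c : 'I_k -> A), (forall i : 'I_k, G i (c i)) ->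
          P (\sum_(i < k) c i) -> forall i, P (c i))].

Definition relevant (G : nat -> A -> Prop) (P : A -> Prop) : Prop :=
  exists n a, (0 < n)%N /\ G n a /\ ~ P a.

Definition closed_subvariety (G : nat -> A -> Prop) (P : A -> Prop) : Prop :=
  hom_prime G P /\ relevant G P.

(* a strictly increasing chain Y_0 < ... < Y_d of closed subvarieties
   (i.e. strictly decreasing chain of their homogeneous primes) *)
Definition subvar_chain (G : nat -> A -> Prop) (d : nat) : Prop :=
  exists Y : nat -> A -> Prop,
    (forall i, (i <= d)%N -> closed_subvariety G (Y i)) /\
    forall i, (i < d)%N ->
      (forall x, Y i.+1 x -> Y i x) /\ exists x, Y i x /\ ~ Y i.+1 x.

Definition proj_dim (G : nat -> A -> Prop) (d : nat) : Prop :=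
  subvar_chain G d /\ ~ subvar_chain G d.+1.

Section Real.
Variable R : realType.
Variable G M : nat -> A -> Prop.
Variable V : nat -> normedModType R.
Variable iota : forall n, A -> V n.

(* (V n, iota n) is the scalar extension R_n (x)_Q R *)
Definition real_ext : Prop :=
  forall n,
  [/\ (forall a b, G n a -> G n b -> iota n (a + b) = iota n a + iota n b),
      (forall (q : rat) a, G n a -> iota n (q *: a) = ratr q *: iota n a),
      (forall k (e : 'I_k -> A), (forall i, G n (e i)) -> Qfree e ->
          forall c : 'I_k -> R, \sum_(i < k) c i *: iota n (e i) = 0 -> forall i, c i = 0)
    & (forall v : V n, exists k (e : 'I_k -> A) (c : 'I_k -> R),
          (forall i, G n (e i)) /\ v = \sum_(i < k) c i *: iota n (e i))].

Definition Rspan_ideal (n : nat) (P : A -> Prop) : set (V n) :=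
  [set v | exists k (e : 'I_k -> A) (c : 'I_k -> R),
      (forall i, G n (e i) /\ P (e i)) /\ v = \sum_(i < k) c i *: iota n (e i)].

Definition quot_norm (n : nat) (P : A -> Prop) (a : A) : R :=
  inf [set r : R | exists v : V n, @Rspan_ideal n P v /\ r = `|iota n a + v|].

Definition lambdaQ (n : nat) : R :=
  if `[< forall x, M n x -> exists m : nat, (0 < m)%N /\ x *+ m = 0 >] then 0
  else inf [set l : R | 0 <= l /\
          exists k (e : 'I_k -> A),
            [/\ (forall i, M n (e i)), Qfree e,
                (forall x, G n x -> Qspan (fun y => exists i, y = e i) x)
              & forall i, `|iota n (e i)| <= l]].
End Real.
End GradedDefs.

(* Main.v *)
(* The costs of lattice generators are measured modulo a filtration, as for
   Gram-Schmidt vectors: if x_1, ..., x_r in the lattice generate R_n over Q and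
   each x_i is congruent to some v_i modulo the span of x_1, ..., x_(i-1), then
   subtracting integral combinations of its predecessors makes every x_i at most
   the sum of the norms of the v_j. This total cost is additive in exact
   sequences. By noetherian induction through
   0 -> R/(I : a) -> R/I -> R/(I + aR) -> 0, the cost of R/I is controlled by
   that of the R/Q for homogeneous primes Q containing I. For P prime and s a
   small section outside P, filtering R/P by the powers of s reduces P to the
   primes strictly containing it and costs one more factor n. Induction on the
   dimension gives a cost O(n^d ups^n), and d <= d(d+1)/2.
   A maximum over a finite set of subvarieties is attained, so one subvariety
   suffices for S. *)
Require Import Defs.
From HB Require Import structures.
From mathcomp Require Import all_boot all_order all_algebra.
From mathcomp Require Import all_classical all_reals all_analysis.
From mathcomp Require Import zify ring lra.
Import Order.TTheory GRing.Theory Num.Theory.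
Import numFieldNormedType.Exports.
Local Open Scope ring_scope.

Set Implicit Arguments. Unset Strict Implicit.

(** * The Hilbert basis theorem *)

Section Noetherian.
Variable A : comNzRingType.
Implicit Types (B I : A -> Prop) (x y g : A).

Definition is_subring B : Prop :=
  [/\ B 1, (forall x y, B x -> B y -> B (x - y))
    & (forall x y, B x -> B y -> B (x * y))].

Definition ideal_in B I : Prop :=
  [/\ I 0, (forall x y, I x -> I y -> I (x + y)),
      (forall b x, B b -> I x -> I (b * x)) & (forall x, I x -> B x)].

Definition acc_ideals B : Prop :=
  forall J : nat -> A -> Prop, (forall i, ideal_in B (J i)) ->
    (forall i x, J i x -> J i.+1 x) ->
    exists N, forall i x, (N <= i)%N -> J i x -> J N x.

Lemma chain_sub (J : nat -> A -> Prop) :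
  (forall i x, J i x -> J i.+1 x) ->
  forall i j x, (i <= j)%N -> J i x -> J j x.
Proof.
move=> JS i j x /subnK <-; elim: (j - i)%N => //= m IHm Jix.
by rewrite addSn; apply/JS/IHm.
Qed.

Definition adjoin B g x : Prop :=
  exists p : {poly A}, (forall i, B p`_i) /\ x = p.[g].

Section Subring.
Variable B : A -> Prop.
Hypothesis Bsub : is_subring B.

Lemma subring0 : B 0.
Proof. by case: Bsub => B1 BB _; rewrite -(subrr 1); apply: BB. Qed.

Lemma subringN x : B x -> B (- x).
Proof. by case: Bsub => _ BB _ Bx; rewrite -sub0r; apply: BB => //; exact: subring0. Qed.

Lemma subringD x y : B x -> B y -> B (x + y).
Proof.
by case: Bsub => _ BB _ Bx By; rewrite -[y]opprK; apply: BB => //; apply: subringN.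
Qed.

Lemma subring_sum (I : Type) (r : seq I) (P : pred I) (F : I -> A) :
  (forall i, B (F i)) -> B (\sum_(i <- r | P i) F i).
Proof.
by move=> BF; apply: big_ind => //; [exact: subring0 | exact: subringD].
Qed.

Lemma sub_adjoin g x : B x -> adjoin B g x.
Proof.
move=> Bx; exists x%:P; split; last by rewrite hornerC.
by move=> i; rewrite coefC; case: ifP => // _; exact: subring0.
Qed.

Lemma mem_adjoin g : adjoin B g g.
Proof.
exists 'X; split; last by rewrite hornerX.
by move=> i; rewrite coefX; case: eqP => // _; [case: Bsub | exact: subring0].
Qed.

Lemma adjoin_subring g : is_subring (adjoin B g).
Proof.
split; first by apply: sub_adjoin; case: Bsub.
- move=> _ _ [p [Bp ->]] [q [Bq ->]]; exists (p - q); rewrite hornerD hornerN.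
  by split=> // i; rewrite coefB; case: Bsub => _ BB _; apply: BB.
move=> _ _ [p [Bp ->]] [q [Bq ->]]; exists (p * q); rewrite hornerM.
split=> // i; rewrite coefM; apply: subring_sum => j.
by case: Bsub => _ _; apply.
Qed.

(* Hilbert basis theorem: an ideal of [B[g]] is controlled by the ideals of [B]
   formed by its leading coefficients of each degree. *)
Lemma acc_adjoin g : acc_ideals B -> acc_ideals (adjoin B g).
Proof.
move=> accB J idJ JS.
have [B1 BB BM] := Bsub.
(* The coefficient of index [k] may vanish, which makes [L i k] an ideal of [B]; it grows with [i]
   and, through multiplication by ['X], with [k]. *)
pose L i k b := exists p : {poly A},
  [/\ forall j, B p`_j, (size p <= k.+1)%N, p`_k = b & J i p.[g]].
have idL i k : ideal_in B (L i k).
  have [J0 JD JM JB] := idJ i; split.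
  - exists 0; split; rewrite ?size_poly0 ?coef0 ?horner0 // => j.
    by rewrite coef0; exact: subring0.
  - move=> _ _ [p [Bp sp <- Jp]] [q [Bq sq <- Jq]]; exists (p + q); split.
    + by move=> j; rewrite coefD; apply: subringD.
    + by rewrite (leq_trans (size_polyD _ _)) // geq_max sp.
    + by rewrite coefD.
    + by rewrite hornerD; apply: JD.
  - move=> b _ Bb [p [Bp sp <- Jp]]; exists (b *: p); split.
    + by move=> j; rewrite coefZ; apply: BM.
    + exact: leq_trans (size_scale_leq _ _) sp.
    + by rewrite coefZ.
    + by rewrite hornerZ; apply: JM => //; apply: sub_adjoin.
  - by move=> _ [p [Bp _ <- _]]; apply: Bp.
have LSi k i b : L i k b -> L i.+1 k b.
  by move=> [p [Bp sp pk Jp]]; exists p; split => //; apply: JS.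
have LSk i k b : L i k b -> L i k.+1 b.
  move=> [p [Bp sp pk Jp]]; exists (p * 'X); split.
  - by move=> j; rewrite coefMX; case: eqP => // _; exact: subring0.
  - by rewrite (leq_trans (size_polyMleq _ _)) // size_polyX addn2.
  - by rewrite coefMX.
  - have [_ _ JM _] := idJ i; rewrite hornerM hornerX mulrC; apply: JM => //.
    exact: mem_adjoin.
have Li k := @chain_sub (fun i => L i k) (LSi k).
have Lk i := @chain_sub (L i) (LSk i).
(* The diagonal chain is stationary from [N] on; this settles all [k >= N] at once and leaves
   finitely many [k], treated one by one. *)
have [N LN] : exists N, forall i b, (N <= i)%N -> L i i b -> L N N b.
  by apply: (accB (fun i => L i i)) => // i x /LSi/LSk.
have LN' i k b : (N <= i)%N -> (N <= k)%N -> L i k b -> L N k b.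
  move=> Ni Nk Lb; apply: (Lk N N k) => //.
  apply: (LN (maxn i k)); first by rewrite leq_max Ni.
  by apply: (Li _ i); rewrite ?leq_maxl //; apply: (Lk _ k); rewrite ?leq_maxr.
have LK K : exists M, (N <= M)%N /\
    forall k i b, (k < K)%N -> (M <= i)%N -> L i k b -> L M k b.
  elim: K => [|K [M [NM LM]]]; first by exists N; split.
  have [M' LM'] := accB _ (idL^~ K) (LSi K).
  exists (maxn M M'); split; first by rewrite leq_max NM.
  move=> k i b; rewrite ltnS leq_eqVlt geq_max => /orP[/eqP-> | kK] /andP[Mi Mi'] Lb.
    by apply: (Li _ M'); [exact: leq_maxr | exact: LM' Lb].
  by apply: (Li _ M); [exact: leq_maxl | exact: LM Lb].
have [M [NM LM]] := LK N; exists M => i x Mi Jx.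
have [_ _ _ JB] := idJ i; have [p [Bp px]] := JB _ Jx.
rewrite {x JB}px in Jx *; move: {2}(size p) (leqnn (size p)) => k.
elim: k p Bp Jx => [|k IHk] p Bp Jp sp.
  have [J0 _ _ _] := idJ M.
  by move: sp; rewrite leqn0 size_poly_eq0 => /eqP->; rewrite horner0.
(* Cancel the top coefficient of [p] by a [q] from stage [M]; the difference stays in stage [i] and
   its size bound drops by one. *)
have [q [Bq sq qk Jq]] : L M k p`_k.
  have Lik : L i k p`_k by exists p; split.
  have [kN|Nk] := ltnP k N; first exact: LM Lik.
  by apply: (Li _ N) => //; apply: LN' Lik => //; exact: leq_trans Mi.
have [_ JD JM _] := idJ M; have [_ JDi JMi _] := idJ i.
have BN1 : adjoin B g (- 1) by apply: sub_adjoin; apply: subringN.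
have -> : p.[g] = (p - q).[g] + q.[g] by rewrite hornerD hornerN subrK.
apply: JD => //; apply: IHk.
- by move=> j; rewrite coefB; apply: BB.
- rewrite hornerD hornerN -mulN1r; apply: JDi => //; apply: JMi => //.
  exact: (@chain_sub J JS M).
apply/leq_sizeP => j; rewrite leq_eqVlt => /orP[/eqP<-|kj].
  by rewrite coefB qk subrr.
rewrite coefB (leq_sizeP _ _ sp) // (leq_sizeP _ _ sq) ?subrr //.
Qed.

End Subring.

Fixpoint adjoin_seq B (s : seq A) : A -> Prop :=
  if s is g :: s' then adjoin (adjoin_seq B s') g else B.

Lemma adjoin_seq_subring B s : is_subring B -> is_subring (adjoin_seq B s).
Proof. by move=> Bsub; elim: s => //= g s IHs; apply: adjoin_subring. Qed.

Lemma acc_adjoin_seq B s :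
  is_subring B -> acc_ideals B -> acc_ideals (adjoin_seq B s).
Proof.
move=> Bsub accB; elim: s => //= g s IHs.
by apply: acc_adjoin => //; apply: adjoin_seq_subring.
Qed.

Lemma sub_adjoin_seq B s x : is_subring B -> B x -> adjoin_seq B s x.
Proof.
move=> Bsub Bx; elim: s => //= g s IHs.
by apply: sub_adjoin => //; apply: adjoin_seq_subring.
Qed.

Lemma mem_adjoin_seq B s g : is_subring B -> g \in s -> adjoin_seq B s g.
Proof.
move=> Bsub; elim: s => //= h s IHs; rewrite inE => /orP[/eqP->|/IHs gs].
  by apply: mem_adjoin; apply: adjoin_seq_subring.
by apply: sub_adjoin => //; apply: adjoin_seq_subring.
Qed.

Definition is_ideal I : Prop := ideal_in (fun=> True) I.

(** A failing ideal has a strictly larger failing one; dependent choice turns this into a strictly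
    ascending chain, against [acc_ideals]. *)
Lemma noetherian_ind (Phi : (A -> Prop) -> Prop) :
  acc_ideals (fun=> True) ->
  (forall I, is_ideal I ->
     (forall J, is_ideal J -> (forall x, I x -> J x) -> (exists x, J x /\ ~ I x) ->
        Phi J) -> Phi I) ->
  forall I, is_ideal I -> Phi I.
Proof.
move=> acc step I0 idI0; apply: contrapT => nPhi0.
pose T := {I : A -> Prop | is_ideal I /\ ~ Phi I}.
pose lt (I J : T) := (forall x, sval I x -> sval J x) /\
  (exists x, sval J x /\ ~ sval I x).
have next (I : T) : {J : T | lt I J}.
  apply: cid; case: I => I [idI nPhi]; apply: contrapT => noJ; apply: (nPhi).
  apply: step => // J idJ IJ neq; apply: contrapT => nPhiJ.
  by apply: noJ; exists (exist _ J (conj idJ nPhiJ)).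
have [f [_ fS]] := dependent_choice next (exist _ I0 (conj idI0 nPhi0)).
have [|i x|N fN] := acc (fun i => sval (f i)).
- by move=> i; case: (svalP (f i)).
- by case: (fS i) => + _; apply.
have [_ [x [fx nfx]]] := fS N.
by apply/nfx/(fN N.+1).
Qed.

End Noetherian.

(** The image of [rat] is a field, whose only ideals are zero and itself; adjoining the generators
    one by one then reaches all of [A]. *)
Lemma finite_type_acc (A : comAlgType rat) :
  finite_type A -> @acc_ideals A (fun=> True).
Proof.
move=> [k [g gen]].
pose B (x : A) := exists q : rat, x = q%:A.
have Bsub : is_subring B.
  split; first by exists 1; rewrite scale1r.
    by move=> _ _ [q ->] [r ->]; exists (q - r); rewrite scalerBl.
  by move=> _ _ [q ->] [r ->]; exists (q * r); rewrite -scalerAl mul1r scalerA.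
have accB : acc_ideals B.
  move=> J idJ JS.
  have [[N [x [JNx x0]]]|all0] := EM (exists N x, J N x /\ x <> 0).
    exists N => i y _ Jy; have [_ _ JM JB] := idJ N.
    have [q xq] := JB _ JNx; have [_ _ _ JBi] := idJ i.
    have [r ->] := JBi _ Jy.
    have q0 : q != 0 by apply/eqP => q0; apply: x0; rewrite xq q0 scale0r.
    have -> : r%:A = (r / q)%:A * x.
      by rewrite xq -scalerAl mul1r scalerA divfK.
    by apply: JM => //; exists (r / q).
  exists 0%N => i x _ Jx; have [-> //|x0] := EM (x = 0); first by case: (idJ 0%N).
  by case: all0; exists i, x.
have subC := adjoin_seq_subring (codom g) Bsub.
have all x : adjoin_seq B (codom g) x.
  apply: (gen (adjoin_seq B (codom g))) => [|i]; last first.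
    by apply: mem_adjoin_seq => //; exact: codom_f.
  have QB (q : rat) : adjoin_seq B (codom g) q%:A.
    by apply: sub_adjoin_seq => //; exists q.
  have [C1 CB CM] := subC; split=> //; split.
  - exact: subring0.
  - exact: subringD.
  - by move=> q y Cy; rewrite -mulr_algl; apply: CM.
have -> : (fun=> True) = adjoin_seq B (codom g).
  by apply: funext => x; apply: propext; split.
exact: acc_adjoin_seq.
Qed.

(** * Homogeneous ideals *)

Section Graded.
Variables (A : comAlgType rat) (G : nat -> A -> Prop).
Hypothesis grG : is_grading G.
Implicit Types (I P : A -> Prop) (a b x y : A).

Lemma gr0 n : G n 0. Proof. by case: grG => QG _ _ _ _; case: (QG n). Qed.

Lemma grD n x y : G n x -> G n y -> G n (x + y).
Proof. by case: grG => QG _ _ _ _; case: (QG n) => _ + _; apply. Qed.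

Lemma grZ n q x : G n x -> G n (q *: x).
Proof. by case: grG => QG _ _ _ _; case: (QG n) => _ _; apply. Qed.

Lemma grB n x y : G n x -> G n y -> G n (x - y).
Proof. by move=> Gx Gy; rewrite -scaleN1r; apply/grD/grZ. Qed.

Lemma grM n m a b : G n a -> G m b -> G (n + m)%N (a * b).
Proof. by case: grG => _ _ GM _ _; apply: GM. Qed.

Lemma grMl n m a b : (n <= m)%N -> G n a -> G (m - n)%N b -> G m (a * b).
Proof. by move=> nm Ga Gb; rewrite -(subnKC nm); apply: grM. Qed.

Lemma gr_sum n (T : Type) (r : seq T) (Q : pred T) (F : T -> A) :
  (forall i, G n (F i)) -> G n (\sum_(i <- r | Q i) F i).
Proof. by move=> GF; apply: big_ind => //; [exact: gr0 | exact: grD]. Qed.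

Lemma gr_indep k (c : nat -> A) :
  (forall i, G i (c i)) -> \sum_(i < k) c i = 0 ->
  forall i, (i < k)%N -> c i = 0.
Proof.
move=> Gc sum0 i ik; case: grG => _ _ _ _ indep.
by apply: (indep k (fun i : 'I_k => c i) _ sum0 (Ordinal ik)) => j; apply: Gc.
Qed.

Definition comps x (c : nat -> A) : Prop :=
  (forall i, G i (c i)) /\
  exists k, (forall i, (k <= i)%N -> c i = 0) /\ x = \sum_(i < k) c i.

Lemma ex_comps x : exists c, comps x c.
Proof.
case: grG => _ _ _ dec _; have [k [c [Gc ->]]] := dec x.
exists (fun i => oapp c 0 (insub i)); split.
  by move=> i; case: insubP => [j _ <- /=|_ /=]; [exact: Gc | exact: gr0].
exists k; split; first by move=> i ki; rewrite insubF // ltnNge ki.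
by apply: eq_bigr => i _; rewrite valK.
Qed.

Definition comp x : nat -> A := projT1 (cid (ex_comps x)).

Lemma compP x : comps x (comp x).
Proof. exact: projT2 (cid (ex_comps x)). Qed.

Lemma big_ord_trunc (c : nat -> A) k K :
  (forall i, (k <= i)%N -> c i = 0) -> (k <= K)%N ->
  \sum_(i < K) c i = \sum_(i < k) c i.
Proof.
move=> c0 kK; rewrite -(subnKC kK) big_split_ord /= [X in _ + X]big1 ?addr0 //.
by move=> i _; apply/c0/leq_addr.
Qed.

Lemma comp_unique x c : comps x c -> comp x =1 c.
Proof.
move=> [Gc [k [c0 xc]]] i; have [Gp [l [p0 xp]]] := compP x.
have [im|mi] := ltnP i (maxn k l); last first.
  by move: mi; rewrite geq_max => /andP[ki li]; rewrite c0 ?p0.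
apply/eqP; rewrite -subr_eq0; apply/eqP.
apply: (@gr_indep (maxn k l) (fun i => comp x i - c i)) => //.
  by move=> j; apply: grB.
rewrite sumrB (big_ord_trunc p0) ?leq_maxr // (big_ord_trunc c0) ?leq_maxl //.
by rewrite -xc -xp subrr.
Qed.

Lemma gr_comp x n : G n (comp x n). Proof. by case: (compP x). Qed.

Lemma comp_sum x :
  exists k, (forall i, (k <= i)%N -> comp x i = 0) /\ x = \sum_(i < k) comp x i.
Proof. by case: (compP x). Qed.

Lemma compD x y n : comp (x + y) n = comp x n + comp y n.
Proof.
apply: (@comp_unique _ (fun n => comp x n + comp y n)); split.
  by move=> i; apply: grD; apply: gr_comp.
have [k [x0 xk]] := comp_sum x; have [l [y0 yl]] := comp_sum y.
exists (maxn k l); split.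
  by move=> i; rewrite geq_max => /andP[ki li]; rewrite x0 ?y0 ?addr0.
rewrite big_split /= (big_ord_trunc x0) ?leq_maxl //.
by rewrite (big_ord_trunc y0) ?leq_maxr // -xk -yl.
Qed.

Lemma comp_homog m x n : G m x -> comp x n = if n == m then x else 0.
Proof.
move=> Gx; apply: (@comp_unique _ (fun n => if n == m then x else 0)); split.
  by move=> i; case: eqP => [->|_] //; exact: gr0.
exists m.+1; split; first by move=> i; case: eqP => // ->; rewrite ltnn.
rewrite big_ord_recr /= eqxx big1 ?add0r // => i _.
by rewrite ltn_eqF.
Qed.

Lemma comp0 n : comp 0 n = 0.
Proof. by rewrite (comp_homog n (gr0 n)) eqxx. Qed.

Lemma comp_bigsum k (F : 'I_k -> A) n :
  comp (\sum_(i < k) F i) n = \sum_(i < k) comp (F i) n.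
Proof.
by apply: (big_morph (comp^~ n)) => [x y|]; [exact: compD | exact: comp0].
Qed.

Lemma compMl p a x n : G p a ->
  comp (a * x) n = if (p <= n)%N then a * comp x (n - p) else 0.
Proof.
move=> Ga.
apply: (@comp_unique _ (fun n => if (p <= n)%N then a * comp x (n - p) else 0)).
split=> [i|].
  by case: ifP => [pi|_]; [apply: (grMl pi) => //; exact: gr_comp | exact: gr0].
have [k [x0 xk]] := comp_sum x; exists (p + k)%N; split=> [i ki|].
  by case: ifP => // pi; rewrite x0 ?mulr0 // leq_subRL // addnC.
rewrite {1}xk big_split_ord /= [X in _ = X + _]big1 ?add0r => [|i _]; last first.
  by rewrite leqNgt ltn_ord.
rewrite mulr_sumr; apply: eq_bigr => i _.
by rewrite leq_addr addKn.
Qed.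

Definition hom_ideal I : Prop := is_ideal I /\ forall n x, I x -> I (comp x n).

Section Ideal.
Variable I : A -> Prop.
Hypothesis idI : is_ideal I.

Lemma ideal0 : I 0. Proof. by case: idI. Qed.
Lemma idealD x y : I x -> I y -> I (x + y). Proof. by case: idI => _ + _ _; apply. Qed.
Lemma idealMl x y : I y -> I (x * y). Proof. by case: idI => _ _ + _; apply. Qed.
Lemma idealMr x y : I x -> I (x * y). Proof. by rewrite mulrC; exact: idealMl. Qed.
Lemma idealN x : I x -> I (- x). Proof. by rewrite -mulN1r; exact: idealMl. Qed.
Lemma idealZ (q : rat) x : I x -> I (q *: x).
Proof. by rewrite -mulr_algl; exact: idealMl. Qed.
Lemma idealB x y : I x -> I y -> I (x - y).
Proof. by move=> Ix Iy; apply/idealD/idealN. Qed.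
Lemma ideal_sum (T : Type) (r : seq T) (Q : pred T) (F : T -> A) :
  (forall i, Q i -> I (F i)) -> I (\sum_(i <- r | Q i) F i).
Proof. by move=> IF; apply: big_ind => //; [exact: ideal0 | exact: idealD]. Qed.
End Ideal.

Lemma hom_prime_ideal P : hom_prime G P -> hom_ideal P.
Proof.
move=> [[P0 PD] PM _ _ Pc]; split; first by split=> // b x _; exact: PM.
move=> n x Px.
have [k [x0 xk]] := comp_sum x.
have [nk|kn] := ltnP n k; last by rewrite x0.
rewrite xk in Px.
by apply: (Pc k (fun i : 'I_k => comp x i) _ Px (Ordinal nk)) => i; apply: gr_comp.
Qed.

Lemma least_comp I a : is_ideal I -> ~ I a ->
  exists i, ~ I (comp a i) /\ forall j, (j < i)%N -> I (comp a j).
Proof.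
move=> idI nIa.
have ex : exists i, `[< ~ I (comp a i) >].
  apply: contrapT => nex; apply: nIa; have [k [_ ->]] := comp_sum a.
  apply: ideal_sum => // i _; apply: contrapT => nI; apply: nex; exists i.
  exact/asboolP.
case: (ex_minnP ex) => i /asboolP nI imin; exists i; split=> // j ji.
apply: contrapT => nIj; move: ji; rewrite ltnNge => /negP; apply.
exact/imin/asboolP.
Qed.

(* If neither [a] nor [b] lies in [I], the product of their lowest components
   outside [I] is congruent mod [I] to a component of [a * b]. *)
Lemma hom_ideal_prime I : hom_ideal I -> ~ I 1 ->
  (forall p q a b, G p a -> G q b -> I (a * b) -> I a \/ I b) -> hom_prime G I.
Proof.
move=> [idI Ic] I1 Ip; split => //.
- by split; [exact: ideal0 | exact: idealD].
- by move=> r x; exact: idealMl.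
- move=> a b Iab; apply: contrapT => /not_orP[nIa nIb].
  have [i [nIai ai]] := least_comp idI nIa.
  have [j [nIbj bj]] := least_comp idI nIb.
  have [k [a0 ak]] := comp_sum a.
  have ik : (i < k)%N.
    by rewrite ltnNge; apply/negP => ki; apply: nIai; rewrite a0 //; exact: ideal0.
  have := Ic (i + j)%N _ Iab; rewrite {1}ak mulr_suml comp_bigsum.
  rewrite (bigD1 (Ordinal ik)) //= (compMl _ _ (gr_comp a i)) leq_addr addKn.
  set S := (\sum_(_ < _ | _) _) => Isum.
  have IS : I S.
    apply: ideal_sum => // l; rewrite -val_eqE /= => li.
    rewrite (compMl _ _ (gr_comp a l)); case: ifP => [lij|_]; last exact: ideal0.
    have [lt|ge] := ltnP l i; first by apply: idealMr => //; exact: ai.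
    apply: idealMl => //; apply: bj; rewrite ltn_subLR //.
    by rewrite ltn_add2r ltn_neqAle eq_sym li.
  have Iij : I (comp a i * comp b j) by rewrite -[_ * _](addrK S); apply: idealB.
  by case: (Ip _ _ _ _ (gr_comp a i) (gr_comp b j) Iij).
- move=> l c Gc Isum i.
  have := Ic i _ Isum; rewrite comp_bigsum (bigD1 i) //= (comp_homog _ (Gc i)) eqxx.
  rewrite big1 ?addr0 // => j ji; rewrite (comp_homog _ (Gc j)) ifN //.
  by rewrite eq_sym.
Qed.

(** * Principal extensions [I + aA] and colon ideals [(I : a)] *)

Definition add_principal I a x : Prop := exists y r, I y /\ x = y + a * r.

Definition colon I a x : Prop := I (a * x).

Lemma add_principal_hom I p a : hom_ideal I -> G p a -> hom_ideal (add_principal I a).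
Proof.
move=> [idI Ic] Ga; split.
  split=> //.
  - by exists 0, 0; rewrite mulr0 addr0; split=> //; exact: ideal0.
  - move=> _ _ [x [r [Ix ->]]] [y [s [Iy ->]]]; exists (x + y), (r + s).
    by rewrite mulrDr addrACA; split=> //; apply: idealD.
  - move=> b _ _ [x [r [Ix ->]]]; exists (b * x), (b * r).
    by rewrite mulrDr mulrCA; split=> //; apply: idealMl.
move=> n _ [y [r [Iy ->]]]; exists (comp y n).
exists (if (p <= n)%N then comp r (n - p) else 0); split; first exact: Ic.
by rewrite compD (compMl _ _ Ga); case: ifP; rewrite ?mulr0.
Qed.

Lemma sub_add_principal I a x : I x -> add_principal I a x.
Proof. by move=> Ix; exists x, 0; rewrite mulr0 addr0. Qed.

Lemma mem_add_principal I a : is_ideal I -> add_principal I a a.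
Proof. by move=> idI; exists 0, 1; rewrite mulr1 add0r; split=> //; exact: ideal0. Qed.

(** Taking components of degree [n] makes both terms homogeneous; below degree [p] a multiple of [a]
    has zero component, so [r = 0] works there. *)
Lemma add_principal_gr I p a n x : hom_ideal I -> G p a -> G n x ->
  add_principal I a x ->
  exists y r, [/\ I y, G n y, x = y + a * r & if (p <= n)%N then G (n - p)%N r else r = 0].
Proof.
move=> [idI Ic] Ga Gx [y [r [Iy xyr]]].
exists (comp y n), (if (p <= n)%N then comp r (n - p) else 0); split.
- exact: Ic.
- exact: gr_comp.
- have := comp_homog n Gx; rewrite eqxx => {1}<-; rewrite xyr compD (compMl _ _ Ga).
  by case: ifP; rewrite ?mulr0.
- by case: (p <= n)%N => //; exact: gr_comp.
Qed.

Lemma colon_hom I p a : hom_ideal I -> G p a -> hom_ideal (colon I a).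
Proof.
move=> [idI Ic] Ga; split.
  split=> //; rewrite /colon.
  - by rewrite mulr0; exact: ideal0.
  - by move=> x y Ix Iy; rewrite mulrDr; apply: idealD.
  - by move=> b x _ Ix; rewrite mulrCA; apply: idealMl.
move=> n x /(Ic (n + p)%N); rewrite /colon (compMl _ _ Ga) leq_addl.
by rewrite addnK.
Qed.

End Graded.

(** * Costs of filtrations by lattice elements *)

Section Lattice.
Variables (A : comAlgType rat) (R : realType) (G M : nat -> A -> Prop).
Variable N : nat -> A -> R.
Hypothesis grG : is_grading G.
Hypothesis intM : is_integral_structure G M.
Hypothesis N_ge0 : forall n x, 0 <= N n x.
Hypothesis ND : forall n x y, G n x -> G n y -> N n (x + y) <= N n x + N n y.
Hypothesis NZ : forall n (q : rat) x, G n x -> N n (q *: x) = `|ratr q| * N n x.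
Hypothesis NM_int : forall n m a b, M n a -> M m b ->
  N (n + m)%N (a * b) <= N n a * N m b.
Implicit Types (U W : A -> Prop) (x y : A).

Lemma lat0 n : M n 0. Proof. by case: intM => Msub _ _ _ _; case: (Msub n). Qed.

Lemma latB n x y : M n x -> M n y -> M n (x - y).
Proof. by case: intM => Msub _ _ _ _; case: (Msub n) => _; apply. Qed.

Lemma latN n x : M n x -> M n (- x).
Proof. by move=> Mx; rewrite -sub0r; apply: latB => //; exact: lat0. Qed.

Lemma latD n x y : M n x -> M n y -> M n (x + y).
Proof. by move=> Mx My; rewrite -[y]opprK; apply/latB/latN. Qed.

Lemma latMn n x k : M n x -> M n (x *+ k).
Proof.
move=> Mx; elim: k => [|k IHk]; first by rewrite mulr0n; exact: lat0.
by rewrite mulrS; exact: latD.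
Qed.

Lemma latMz n x (z : int) : M n x -> M n (x *~ z).
Proof.
by move=> Mx; case: z => k; [exact: latMn | exact/latN/latMn].
Qed.

Lemma lat_gr n x : M n x -> G n x. Proof. by case: intM => _ + _ _ _; apply. Qed.

Lemma latM n m a b : M n a -> M m b -> M (n + m)%N (a * b).
Proof. by case: intM => _ _ [_ MM] _ _; apply: MM. Qed.

Lemma lat_denom n x : G n x -> exists k : nat, (0 < k)%N /\ M n (x *+ k).
Proof.
case: intM => _ _ _ _ span /span[k [e [q [Me ->]]]].
elim: k e q Me => [|k IHk] e q Me.
  by exists 1%N; rewrite big_ord0; split=> //; exact: lat0.
have [|K [K0 MK]] := IHk (fun i => e (widen_ord (leqnSn k) i))
  (fun i => q (widen_ord (leqnSn k) i)); first by move=> i; apply: Me.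
set q0 := q ord_max; set e0 := e ord_max.
exists (K * `|denq q0|)%N; split; first by rewrite muln_gt0 K0 absz_gt0 denq_neq0.
rewrite big_ord_recr /= mulrnDl; apply: latD.
  by rewrite mulrnA; apply: latMn.
rewrite -/q0 -/e0 mulnC mulrnA; apply: latMn.
suff -> : q0 *: e0 *+ `|denq q0| = e0 *~ numq q0 by apply/latMz/Me.
rewrite scalerMnl -[e0 in RHS]scale1r scalerMzl; congr (_ *: _).
by rewrite -mulr_natr natr_absz ger0_norm ?denq_ge0 // -numqE.
Qed.

Lemma N0 n : N n 0 = 0.
Proof. by rewrite -(scale0r 0) NZ ?rmorph0 ?normr0 ?mul0r //; exact: gr0. Qed.

Lemma NMn n x k : G n x -> N n (x *+ k) = k%:R * N n x.
Proof. by move=> Gx; rewrite -scaler_nat NZ // ratr_nat ger0_norm. Qed.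

(** Submultiplicativity is assumed only on the lattice; clearing denominators and homogeneity of the
    norm carry it to rational elements. *)
Lemma NM n m a b : G n a -> G m b -> N (n + m)%N (a * b) <= N n a * N m b.
Proof.
move=> Ga Gb; have [k [k0 Mka]] := lat_denom Ga; have [l [l0 Mlb]] := lat_denom Gb.
have := NM_int Mka Mlb; rewrite mulrnAl mulrnAr -mulrnA !NMn //; last exact: grM.
by rewrite mulrACA -natrM mulnC ler_pM2l ?ltr0n ?muln_gt0 ?k0.
Qed.

(* [reach n U W T]: [W] is obtained from [U] by successively adjoining lattice
   elements [x], each congruent to some [v] modulo the part already built, with
   total cost [T] the sum of the norms of the [v]. As with Gram-Schmidt vectors,
   costs add up along a filtration, without rank factors. *)
Inductive reach (n : nat) U : (A -> Prop) -> R -> Prop :=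
| Reach0 W T : (forall w, W w -> U w) -> 0 <= T -> reach n U W T
| ReachS W W' T T' x v : reach n U W T -> M n x -> G n v -> W (x - v) ->
    (forall w, W' w -> exists u (q : rat), W u /\ w = u + q *: x) ->
    T + N n v <= T' -> reach n U W' T'.

Lemma reach_sub n U W W' T T' : reach n U W T -> (forall w, W' w -> W w) ->
  T <= T' -> reach n U W' T'.
Proof.
case=> {W T} [W T WU T0|W0 W T0 T x v r0 Mx Gv Wxv Wdec le] W'W TT'.
  by apply: Reach0; [move=> w /W'W/WU | exact: le_trans T0 TT'].
apply: (ReachS r0 Mx Gv Wxv) => [w /W'W/Wdec //|].
exact: le_trans le TT'.
Qed.

Lemma reach_trans n U W Z T T' :
  reach n U W T -> reach n W Z T' -> reach n U Z (T + T').
Proof.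
move=> rUW; elim=> {Z T'} [Z T' ZW T'0|Z Z' T1 T2 x v _ IH Mx Gv Zxv Zdec le].
  by apply: reach_sub rUW ZW _; rewrite lerDl.
by apply: (ReachS IH Mx Gv Zxv Zdec); rewrite -addrA lerD2l.
Qed.

(** Two maps are needed: [f] is linear and preserves the lattice, [g] controls the norms of the
    representatives [v], and they agree modulo [U']. Later [f] multiplies by a lattice section and
    [g] by a rational element of controlled norm congruent to it. *)
Lemma reach_map n m (f g : A -> A) (c : R) U U' W T :
  {morph f : x y / x + y} -> (forall q : rat, {morph f : x / q *: x}) ->
  0 <= c ->
  (forall x, M n x -> M m (f x)) ->
  (forall v, G n v -> G m (g v) /\ N m (g v) <= c * N n v) ->
  U' 0 -> (forall x y, U' x -> U' y -> U' (x + y)) ->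
  (forall u, U u -> U' (f u)) ->
  (forall v, G n v -> U' (f v - g v)) ->
  reach n U W T ->
  reach m U' (fun y => exists u w, [/\ U' u, W w & y = u + f w]) (c * T).
Proof.
move=> fD fZ; have fN x : f (- x) = - f x by rewrite -scaleN1r fZ scaleN1r.
move=> c0 fM gG U0 UD fU fgU.
elim=> {W T} [W T WU T0|W W' T T' x v _ IH Mx Gv Wxv Wdec le].
  apply: Reach0; last exact: mulr_ge0.
  by move=> _ [u [w [U'u /WU/fU U'w ->]]]; apply: UD.
have [Gg Ng] := gG v Gv.
apply: (ReachS IH (fM _ Mx) Gg).
- exists (f v - g v), (x - v); split=> //; first exact: fgU.
  by rewrite fD fN [RHS]addrC addrA subrK.
- move=> _ [u [w' [U'u /Wdec[w [q [Ww ->]]] ->]]].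
  exists (u + f w), q; split; first by exists u, w; split.
  by rewrite fD fZ addrA.
- by rewrite (le_trans _ (ler_wpM2l c0 le)) // mulrDr lerD2l.
Qed.

Lemma reach_base n U U' W T :
  U' 0 -> (forall x y, U' x -> U' y -> U' (x + y)) ->
  (forall u, U u -> U' u) -> reach n U W T -> reach n U' W T.
Proof.
move=> U0 UD UU' r.
have r' : reach n U' (fun y => exists u w, [/\ U' u, W w & y = u + w]) (1 * T).
  apply: (@reach_map n n idfun idfun 1 U) r => // v Gv; first by rewrite mul1r.
  by rewrite subrr.
apply: reach_sub r' _ _ => [w Ww|]; last by rewrite mul1r.
by exists 0, w; rewrite add0r; split.
Qed.

(** Adjoin the lattice generators one at a time, each serving as its own [v]; clearing denominators
    shows that their rational span is [G n]. *)
Lemma reach_finite n U : U 0 -> exists T, reach n U (G n) T.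
Proof.
move=> U0; case: intM => _ _ _ /(_ n)[k [g [Mg gen]]] _.
have [T rT] : exists T, reach n U (fun x => exists q : 'I_k -> rat,
    x = \sum_(i < k) q i *: g i) T.
  elim: k g Mg {gen} => [|k IHk] g Mg.
    exists 0; apply: Reach0 => // _ [q ->]; by rewrite big_ord0.
  have [|T rT] := IHk (fun i => g (widen_ord (leqnSn k) i)); first by move=> i.
  exists (T + N n (g ord_max)).
  apply: (ReachS rT (Mg ord_max) (lat_gr (Mg ord_max))) => //.
    by exists (fun=> 0); rewrite subrr big1 // => i _; rewrite scale0r.
  move=> _ [q ->]; rewrite big_ord_recr /=.
  exists (\sum_(i < k) q (widen_ord (leqnSn k) i) *: g (widen_ord (leqnSn k) i)).
  by exists (q ord_max); split=> //; exists (fun i => q (widen_ord (leqnSn k) i)).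
exists T; apply: reach_sub rT _ _ => // x Gx.
have [m [m0 /gen[z xz]]] := lat_denom Gx.
exists (fun i => (z i)%:~R / m%:R).
have -> : x = m%:R^-1 *: (x *+ m).
  by rewrite -scaler_nat scalerA mulVf ?scale1r // pnatr_eq0 -lt0n.
rewrite xz scaler_sumr; apply: eq_bigr => i _.
by rewrite -scaler_int scalerA mulrC.
Qed.

Lemma reach_mul n m a a' U U' W T :
  M n a -> G n a' -> U' 0 -> (forall x y, U' x -> U' y -> U' (x + y)) ->
  (forall u, U u -> U' (a * u)) ->
  (forall v, G m v -> U' ((a - a') * v)) ->
  reach m U W T ->
  reach (n + m) U' (fun y => exists u w, [/\ U' u, W w & y = u + a * w]) (N n a' * T).
Proof.
move=> Ma Ga' U0 UD aU aa'U.
apply: (@reach_map _ _ ( *%R a) ( *%R a')) => // [x y|q x|x Mx|v Gv|v Gv].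
- exact: mulrDr.
- by rewrite scalerAr.
- exact: latM.
- by split; [exact: grM | exact: NM].
- by rewrite /= -mulrBl; exact: aa'U.
Qed.

(** Coefficients are peeled off from the head, matching a filtration that grows by one vector at a
    time. *)
Fixpoint spanQ (s : seq A) x : Prop :=
  if s is e :: s' then exists q : rat, spanQ s' (x - q *: e) else x = 0.

Fixpoint spanZ (s : seq A) x : Prop :=
  if s is e :: s' then exists z : int, spanZ s' (x - e *~ z) else x = 0.

Lemma spanQD s x y : spanQ s x -> spanQ s y -> spanQ s (x + y).
Proof.
elim: s x y => [x y -> ->|e s IHs x y [q xq] [r yr]] /=; first by rewrite addr0.
exists (q + r); rewrite scalerDl opprD addrACA; exact: IHs.
Qed.

Lemma spanQZ s (q : rat) x : spanQ s x -> spanQ s (q *: x).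
Proof.
elim: s x => [x ->|e s IHs x [r xr]] /=; first by rewrite scaler0.
by exists (q * r); rewrite -scalerA -scalerBr; exact: IHs.
Qed.

Lemma spanZ_Q s x : spanZ s x -> spanQ s x.
Proof.
elim: s x => //= e s IHs x [z xz]; exists z%:~R; rewrite scaler_int; exact: IHs.
Qed.

Lemma spanZ_lat n s x : (forall e, e \in s -> M n e) -> spanZ s x -> M n x.
Proof.
elim: s x => [x _ ->|e s IHs x Ms [z xz]] /=; first exact: lat0.
rewrite -(subrK (e *~ z) x); apply: latD.
  by apply: IHs => // e' e's; apply: Ms; rewrite inE e's orbT.
by apply/latMz/Ms; rewrite inE eqxx.
Qed.

Lemma spanQ_gr n s x : (forall e, e \in s -> M n e) -> spanQ s x -> G n x.
Proof.
elim: s x => [x _ ->|e s IHs x Ms [q xq]] /=; first exact: gr0.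
rewrite -(subrK (q *: e) x); apply: (grD grG).
  by apply: IHs => // e' e's; apply: Ms; rewrite inE e's orbT.
by apply: (grZ grG); apply/lat_gr/Ms; rewrite inE eqxx.
Qed.

(* Size reduction: the lattice generated so far has covering radius at most the
   cost, so the next generator can be moved within that distance of its [v]. *)
Lemma reach_short n W T :
  reach n (eq^~ 0) W T ->
  0 <= T /\ exists s : seq A,
    [/\ forall e, e \in s -> M n e /\ N n e <= T,
        forall w, W w -> spanQ s w
      & forall w, spanQ s w -> exists z, spanZ s z /\ N n (w - z) <= T].
Proof.
elim=> {W T} [W T W0 T0|W W' T T' x v _ [T0 [s [sM sW cov]]] Mx Gv Wxv Wdec le].
  split=> //; exists [::]; split=> //= w ->.
  by exists 0; rewrite subrr N0.
have Nv0 := N_ge0 n v.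
have sM' e : e \in s -> M n e by move=> /sM[].
have TT' : T <= T' by apply: le_trans le; rewrite lerDl.
split; first exact: le_trans TT'.
(* [z] is a lattice point near [x - v], so [e = x - z] differs from [v] by a vector of norm at most
   the old cost [T]. *)
have [z [sz Nz]] := cov _ (sW _ Wxv).
have Mz := spanZ_lat sM' sz.
pose e := x - z; have Me : M n e by exact: latB.
have Gd := spanQ_gr sM' (sW _ Wxv).
have sd : spanQ s (x - v - z).
  rewrite -[- z]scaleN1r; apply: spanQD; first exact: sW.
  exact/spanQZ/spanZ_Q.
have eE : e = v + (x - v - z) by rewrite addrA [v + _]addrC subrK.
exists (e :: s); split.
- move=> e'; rewrite inE => /orP[/eqP->|/sM[Me' Ne']]; last first.
    by split=> //; exact: le_trans TT'.
  split=> //; apply: le_trans le; rewrite eE.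
  apply: le_trans (ND Gv (spanQ_gr sM' sd)) _.
  by rewrite addrC lerD2r.
- move=> _ /Wdec[u [q [Wu ->]]] /=; exists q.
  rewrite /e scalerBr opprB addrACA subrr addr0.
  by apply: spanQD; [exact: sW | exact/spanQZ/spanZ_Q].
move=> w /= [q]; set u := w - q *: e => su.
(* Round the coefficient of [e] down; the leftover [f *: e] splits into [f *: v], of norm at most
   [N n v], and a vector of the old span, which [cov] handles. *)
pose m := Num.floor q; pose f := q - m%:~R.
have f0 : 0 <= f by rewrite subr_ge0 floor_le.
have f1 : f <= 1.
  by rewrite lerBlDl ltW // -[1]/(1%:~R) -intrD1 ?floorD1_gt.
have su' : spanQ s (u + f *: (x - v - z)) by apply/spanQD/spanQZ.
have [z' [sz' Nz']] := cov _ su'.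
exists (z' + e *~ m); split; first by exists m; rewrite addrK.
have -> : w - (z' + e *~ m) = f *: v + (u + f *: (x - v - z) - z').
  rewrite addrA addrCA -scalerDr -eE /f scalerBl scaler_int /u.
  by rewrite addrA subrK opprD addrA addrAC.
apply: le_trans (ND (grZ grG f Gv) (grB grG (spanQ_gr sM' su') _)) _.
  exact/lat_gr/(spanZ_lat sM' sz').
apply: le_trans le; rewrite addrC; apply: lerD => //.
by rewrite NZ // ger0_norm ?ler0q // ler_piMl // -[X in _ <= X](rmorph1 (@ratr R)) ler_rat.
Qed.

Lemma spanQ_family s x :
  spanQ s x -> exists q : nat -> rat, x = \sum_(i < size s) q i *: s`_i.
Proof.
elim: s x => [x ->|e s IHs x [q /IHs[r xE]]] /=.
  by exists (fun=> 0); rewrite big_ord0.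
exists (fun i => if i is j.+1 then r j else q).
by rewrite big_ord_recl /= -xE addrC subrK.
Qed.

(** [reach_short] gives a spanning list within the norm bound; a spanning family of least size under
    that bound is free, since a relation would let one member be dropped. *)
Lemma reach_basis n T : reach n (eq^~ 0) (G n) T ->
  0 <= T /\ exists k (e : 'I_k -> A),
    [/\ forall i, M n (e i), Qfree e,
        forall x, G n x -> Qspan (fun y => exists i, y = e i) x
      & forall i, N n (e i) <= T].
Proof.
move=> /reach_short[T0 [s [sM sG _]]]; split=> //.
pose gen k := exists e : 'I_k -> A, (forall i, M n (e i) /\ N n (e i) <= T) /\
  forall x, G n x -> exists q : 'I_k -> rat, x = \sum_(i < k) q i *: e i.
have ex : exists k, `[< gen k >].
  exists (size s); apply/asboolP; exists (fun i => s`_i); split=> [i|x /sG].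
    by apply/sM/mem_nth.
  by move=> /spanQ_family[q ->]; exists (fun i => q i).
case: (ex_minnP ex) => k /asboolP[e [eM eG]] kmin; exists k, e.
split=> [i||x /eG[q ->]|i]; try by case: (eM i).
  move=> q q0 i; apply: contrapT => /eqP qi.
  have: (k <= k.-1)%N; last by have := ltn_ord i; lia.
  apply/kmin/asboolP; exists (fun j => e (lift i j)); split=> // x /eG[r ->].
  exists (fun j => r (lift i j) - r i / q i * q (lift i j)).
  have ei : e i = - \sum_(j < k.-1) (q (lift i j) / q i) *: e (lift i j).
    apply: (scalerI qi); rewrite scalerN scaler_sumr.
    apply/eqP; rewrite -addr_eq0 -[X in _ == X]q0 (bigD1_ord i) //=.
    apply/eqP; congr (_ + _); apply: eq_bigr => j _.
    by rewrite scalerA mulrC divfK.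
  rewrite (bigD1_ord i) //= {1}ei scalerN scaler_sumr -sumrN -big_split /=.
  apply: eq_bigr => j _; rewrite addrC scalerA -scalerBl.
  by congr (_ *: _); ring.
by exists k, e, q; split=> // i; exists i.
Qed.

Definition deg (I : A -> Prop) n x : Prop := I x /\ G n x.

Section DegIdeal.
Variables (I : A -> Prop) (n : nat).
Hypothesis homI : hom_ideal grG I.

Lemma deg0 : deg I n 0.
Proof. by split; [apply: ideal0; case: homI | exact: gr0]. Qed.

Lemma degD x y : deg I n x -> deg I n y -> deg I n (x + y).
Proof.
by move=> [Ix Gx] [Iy Gy]; split; [apply: idealD => //; case: homI | exact: grD].
Qed.
End DegIdeal.

(** * Growth estimates *)

Section Estimates.
Variable ups : (A -> Prop) -> R.
Hypothesis acc : @acc_ideals A (fun=> True).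
Hypothesis ups_gt0 : forall Y, closed_subvariety G Y -> 0 < ups Y.
Hypothesis small : forall Y, closed_subvariety G Y ->
  exists m s, [/\ (0 < m)%N, M m s, ~ Y s &
    forall q, 1 < q -> exists t, [/\ G m t, Y (s - t) & N m t <= ups Y ^+ m * q]].
Hypothesis exY : exists Y, closed_subvariety G Y.
Implicit Types (I P Q Y : A -> Prop).

(** Merging two estimates keeps the larger value of [ups], so one subvariety always suffices. *)
Lemma ups_dir Y1 Y2 : closed_subvariety G Y1 -> closed_subvariety G Y2 ->
  exists Y, [/\ closed_subvariety G Y, ups Y1 <= ups Y & ups Y2 <= ups Y].
Proof.
move=> c1 c2; have [le|lt] := lerP (ups Y1) (ups Y2); first by exists Y2.
by exists Y1; split=> //; exact: ltW.
Qed.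

(* The growth condition is on partial sums so that exponent 0 covers the
   quotients [R / Q] with [Q] irrelevant, which live in degree 0. *)
Definition estimate (e : nat) I : Prop := exists Y (h : nat -> R) (C : R),
  [/\ closed_subvariety G Y, (forall n, 0 <= h n),
      (forall n, \sum_(k < n.+1) h k <= C * n.+1%:R ^+ e)
    & forall n, reach n (deg I n) (G n) (ups Y ^+ n * h n)].

Lemma estimate_leq e e' I : (e <= e')%N -> estimate e I -> estimate e' I.
Proof.
move=> ee' [Y [h [C [cY h0 hC r]]]]; exists Y, h, C; split=> // n.
have C0 : 0 <= C.
  have := hC 0%N; rewrite big_ord_recl big_ord0 addr0 expr1n mulr1.
  exact/le_trans/h0.
apply: le_trans (hC n) _; apply: ler_wpM2l => //.
by apply: ler_weXn2l; rewrite // ler1n.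
Qed.

(** Multiplication by an element of degree [p] shifts costs by [p] degrees; the shifted partial sum
    is an initial part of the original one. *)
Lemma sum_shift_le (h : nat -> R) p n : (forall k, 0 <= h k) ->
  \sum_(k < n) (if (p <= k)%N then h (k - p)%N else 0) <= \sum_(k < n) h k.
Proof.
move=> h0; have [np|pn] := leqP n p.
  rewrite big1 ?sumr_ge0 // => k _.
  by rewrite leqNgt (leq_trans (ltn_ord k) np).
have [m ->] : exists m, n = (p + m)%N by exists (n - p)%N; rewrite subnKC // ltnW.
rewrite [X in X <= _]big_split_ord /= big1 ?add0r => [|k _]; last first.
  by rewrite leqNgt ltn_ord.
rewrite addnC big_split_ord /= -[X in X <= _]addr0.
apply: lerD; last exact: sumr_ge0.
by apply: ler_sum => k _; rewrite leq_addr addKn.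
Qed.

(* From the exact sequence 0 -> R/(I : a) -> R/I -> R/(I + aR) -> 0. *)
Lemma estimate_ext e p a I : hom_ideal grG I -> M p a ->
  estimate e (add_principal I a) -> estimate e (colon I a) -> estimate e I.
Proof.
move=> homI Ma [Y1 [h1 [C1 [cY1 h10 hC1 r1]]]] [Y2 [h2 [C2 [cY2 h20 hC2 r2]]]].
have Ga := lat_gr Ma.
have [Y [cY le1 le2]] := ups_dir cY1 cY2.
have u0 := ups_gt0 cY; have u10 := ups_gt0 cY1; have u20 := ups_gt0 cY2.
(* Writing [ups Y ^+ (n - p)] as [ups Y ^+ n] over [ups Y ^+ p] turns the cost [N p a] of
   multiplying by [a] into this constant. *)
pose c := N p a / ups Y ^+ p.
have c0 : 0 <= c by apply: divr_ge0 => //; exact/exprn_ge0/ltW.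
pose g k := if (p <= k)%N then h2 (k - p)%N else 0.
have g0 k : 0 <= g k by rewrite /g; case: ifP.
exists Y, (fun k => h1 k + c * g k), (C1 + c * C2); split=> // n.
- by rewrite addr_ge0 // mulr_ge0.
- rewrite big_split /= -mulr_sumr mulrDl -mulrA; apply: lerD; first exact: hC1.
  by rewrite ler_wpM2l // (le_trans (sum_shift_le _ _ h20)).
rewrite mulrDr addrC.
have D0 := deg0 n homI; have DD := @degD _ n homI.
have up1 : ups Y1 ^+ n * h1 n <= ups Y ^+ n * h1 n.
  by rewrite ler_wpM2r // lerXn2r // nnegrE ltW.
have r1n : reach n (deg (add_principal I a) n) (G n) (ups Y ^+ n * h1 n).
  exact: reach_sub (r1 n) _ up1.
apply: reach_trans r1n; rewrite /g.
(* Below degree [p] the multiples of [a] contribute nothing, so [I] and [I + aA] agree and no cost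
   arises. *)
have [pn|np] := leqP p n; last first.
  rewrite !mulr0; apply: Reach0 => // x [Ix Gx].
  have [y [r [Iy Gy -> r0]]] := add_principal_gr homI Ga Gx Ix.
  by move: r0; rewrite leqNgt np /= => ->; rewrite mulr0 addr0.
have : reach (p + (n - p)) (deg I n)
    (fun y => exists u w, [/\ deg I n u, G (n - p)%N w & y = u + a * w])
    (N p a * (ups Y2 ^+ (n - p) * h2 (n - p)%N)).
  apply: (@reach_mul _ _ a a (deg (colon I a) (n - p)%N)) => //.
    by move=> u [Iu Gu]; split; [exact: Iu | exact: (grMl grG pn)].
  by move=> v _; rewrite subrr mul0r.
rewrite subnKC // => r; apply: (reach_sub r) => [x [Ix Gx]|].
  have [y [s [Iy Gy -> Gs]]] := add_principal_gr homI Ga Gx Ix.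
  by rewrite pn in Gs; exists y, s.
have -> : ups Y ^+ n * (c * h2 (n - p)%N) =
    N p a * (ups Y ^+ n / ups Y ^+ p * h2 (n - p)%N) by rewrite /c; ring.
rewrite ler_wpM2l // ler_wpM2r // -[n in X in _ <= X](subnKC pn) exprD.
rewrite mulrAC divff ?expf_neq0 ?gt_eqF // mul1r.
by rewrite lerXn2r // nnegrE ltW.
Qed.

(** Noetherian induction: if homogeneous [a] and [b] outside [I] have their product in [I], then
    [I + aA] and [(I : a)] both strictly contain [I], and [estimate_ext] combines their
    estimates. *)
Lemma estimate_primes e I : hom_ideal grG I ->
  (forall Q, hom_prime G Q -> (forall x, I x -> Q x) -> estimate e Q) ->
  estimate e I.
Proof.
move=> homI; move: (homI) => [idI _]; move: I idI homI.
apply: (noetherian_ind acc) => I idI IH homI primes.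
have [I1|nI1] := EM (I 1).
  have [Y cY] := exY; exists Y, (fun=> 0), 0; split=> // n.
    by rewrite big1 // mul0r.
  apply: Reach0; rewrite ?mulr0 // => w Gw; split=> //.
  by rewrite -[w]mulr1; exact: idealMl.
have [[p [q [a [b [Ga Gb Iab nIa nIb]]]]]|prime] :=
    EM (exists p q a b, [/\ G p a, G q b, I (a * b), ~ I a & ~ I b]); last first.
  apply: primes => //; apply: hom_ideal_prime => // p q a b Ga Gb Iab.
  apply: contrapT => /not_orP[nIa nIb]; apply: prime.
  by exists p, q, a, b.
(* [estimate_ext] asks for a lattice element; a positive multiple of [a] is one, and it stays
   outside [I] over [rat]. *)
have [k [k0 Mka]] := lat_denom Ga.
have nIka : ~ I (a *+ k).
  move=> /(idealZ idI k%:R^-1); rewrite -scaler_nat scalerA mulVf ?scale1r //.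
  by rewrite pnatr_eq0 -lt0n.
have Ika : I (a *+ k * b) by rewrite mulrnAl -scaler_nat; exact: idealZ.
have homD := add_principal_hom homI (lat_gr Mka).
have homC := colon_hom homI (lat_gr Mka).
have subC x : I x -> colon I (a *+ k) x by exact: idealMl.
apply: (estimate_ext homI Mka).
  apply: IH => //; first by case: homD.
  - by move=> x; exact: sub_add_principal.
  - by exists (a *+ k); split=> //; exact: mem_add_principal.
  - by move=> Q pQ IQ; apply: primes => // x Ix; apply/IQ/sub_add_principal.
apply: IH => //; first by case: homC.
- by exists b.
- by move=> Q pQ IQ; apply: primes => // x Ix; apply/IQ/subC.
Qed.

(** Such a [Q] contains everything of positive degree, so only degree 0 has a cost, finite by
    [reach_finite]. *)
Lemma estimate_irrelevant Q : hom_prime G Q -> ~ relevant G Q -> estimate 0 Q.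
Proof.
move=> pQ irr; have homQ := hom_prime_ideal grG pQ.
have [Y cY] := exY.
have [T rT] := @reach_finite 0 (deg Q 0) (deg0 0 homQ).
pose h n := if n is 0 then Num.max T 0 else 0.
have T0 : 0 <= Num.max T 0 by rewrite le_max lexx orbT.
exists Y, h, (Num.max T 0); split=> // [[|n] //|n|[|n]].
- by rewrite expr0 mulr1 big_ord_recl big1 ?addr0.
- by rewrite expr0 mul1r; apply: reach_sub rT _ _ => //; rewrite le_max lexx.
apply: Reach0; rewrite ?mulr0 // => w Gw; split=> //.
by apply: contrapT => nQw; apply: irr; exists n.+1, w.
Qed.

(** Induction with [y = (c - 1) / 3]: the new factor and the previous power are both at most
    [1 + y], and [(1 + y) ^+ 2 <= 1 + 3 * y = c] because [y <= 1]. *)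
Lemma exprn_near1 n (c : R) : 1 < c <= 2 -> exists q, 1 < q /\ q ^+ n <= c.
Proof.
elim: n c => [|n IHn] c /andP[c1 c2].
  by exists 2; rewrite expr0 ltW // ltr1n.
pose y := (c - 1) / 3; have y0 : 0 < y by rewrite /y; lra.
have y1 : y <= 1 by rewrite /y; lra.
have [|q1 [q11 q1n]] := IHn (1 + y); first by apply/andP; split; lra.
have [le|lt] := lerP q1 (1 + y).
  exists q1; split=> //; rewrite exprS.
  have -> : c = 1 + y * 3 by rewrite /y; lra.
  have p0 : 0 <= q1 ^+ n by rewrite exprn_ge0 //; lra.
  nra.
exists (1 + y); split; first lra.
rewrite exprS; have -> : c = 1 + y * 3 by rewrite /y; lra.
have : (1 + y) ^+ n <= q1 ^+ n by apply: lerXn2r; rewrite ?nnegrE; lra.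
have : 0 <= (1 + y) ^+ n by rewrite exprn_ge0 //; lra.
nra.
Qed.

(* Filter [R / P] by the powers of a small section [s]. As [s] is only congruent
   to elements [t] with [N m t <= ups P ^+ m * q] for every [q > 1], degree [n]
   is treated with some [q] such that [q ^+ n <= 2]. *)
Lemma prime_bound e P : closed_subvariety G P ->
  (forall Q, hom_prime G Q -> (forall x, P x -> Q x) ->
     (exists x, Q x /\ ~ P x) -> estimate e Q) ->
  exists Y (C : R), [/\ closed_subvariety G Y, 0 <= C &
    forall n, reach n (deg P n) (G n) (C * n.+1%:R ^+ e * ups Y ^+ n)].
Proof.
move=> cP above; have [pP _] := cP; have homP := hom_prime_ideal grG pP.
have [idP _] := homP.
have [m [s [m0 Ms nPs near]]] := small cP; have Gs := lat_gr Ms.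
have [|Y1 [h [C [cY1 h0 hC r]]]] :=
    @estimate_primes e _ (add_principal_hom homP Gs).
  move=> Q pQ sQ; apply: above => // [x Px|].
    by apply: sQ; exact: sub_add_principal.
  by exists s; split=> //; apply: sQ; exact: mem_add_principal.
have [Y [cY leP le1]] := ups_dir cP cY1.
have u0 := ups_gt0 cY; have u10 := ups_gt0 cY1; have uP0 := ups_gt0 cP.
have C0 : 0 <= C.
  have := hC 0%N; rewrite big_ord_recl big_ord0 addr0 expr1n mulr1.
  exact/le_trans/h0.
exists Y, (2 * C); split=> // [|n]; first by rewrite mulr_ge0.
have [q [q1 qn]] : exists q : R, 1 < q /\ q ^+ n <= 2.
  by apply: exprn_near1; rewrite lexx ltr1n.
have [t [Gt Pst Nt]] := near q q1.
(* Powers of [s] filter degree [k] of [A / P] by degrees [k], [k - m], [k - 2m], and so on, of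
   [A / (P + sA)]; the full sum [H k] dominates their total. *)
pose H k := \sum_(i < k.+1) h i.
have H0 k : 0 <= H k by rewrite sumr_ge0.
have Hmono : {homo H : j k / (j <= k)%N >-> j <= k}.
  apply: homo_leq => // [x y z|k]; first exact: le_trans.
  by rewrite /H [X in _ <= X]big_ord_recr lerDl.
have q0 : 0 < q by apply: lt_trans q1.
(* [w] absorbs the slack [q]: as [m >= 1] gives [q <= q ^+ m], one gets [N m t <= w ^+ m], while
   [w ^+ n <= 2 * ups Y ^+ n] in the degree [n] at hand. *)
pose w := q * ups Y; have w0 : 0 < w by rewrite mulr_gt0.
have le1w : ups Y1 <= w by rewrite (le_trans le1) // ler_peMl ?ltW.
suff rk k : reach k (deg P k) (G k) (w ^+ k * H k).
  apply: reach_sub (rk n) _ _ => //.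
  rewrite /w exprMn mulrAC; apply: ler_wpM2r; first exact/exprn_ge0/ltW.
  rewrite -mulrA; apply: ler_pM => //; [exact/exprn_ge0/ltW | exact: hC].
elim/ltn_ind: k => k IHk.
have D0 := deg0 k homP; have DD := @degD _ k homP.
have rk : reach k (deg (add_principal P s) k) (G k) (w ^+ k * h k).
  apply: reach_sub (r k) _ _ => //.
  by rewrite ler_wpM2r // lerXn2r // nnegrE ltW.
have [mk|km] := leqP m k; last first.
  apply: (reach_base (U := deg (add_principal P s) k)) => //.
    move=> x [Ix Gx].
    have [y [z [Py Gy -> z0]]] := add_principal_gr homP Gs Gx Ix.
    by move: z0; rewrite leqNgt km /= => ->; rewrite mulr0 addr0.
  apply: reach_sub rk _ _ => //; apply: ler_wpM2l; first exact/exprn_ge0/ltW.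
  by rewrite /H big_ord_recr lerDr sumr_ge0.
have : reach (m + (k - m)) (deg P k)
    (fun y => exists u w, [/\ deg P k u, G (k - m)%N w & y = u + s * w])
    (N m t * (w ^+ (k - m) * H (k - m)%N)).
  apply: (@reach_mul _ _ s t (deg P (k - m)%N)) => //.
  - by move=> u [Pu Gu]; split; [exact: idealMl | exact: (grMl grG mk)].
  - move=> v Gv; split; first exact: idealMr.
    by apply: (grMl grG mk) => //; exact: grB.
  - by apply: IHk; rewrite ltn_subrL m0 (leq_trans m0 mk).
rewrite subnKC // => rs.
apply: reach_sub (reach_trans (reach_sub rs _ (lexx _)) rk) _ _ => //.
  move=> x [Ix Gx].
  have [y [z [Py Gy -> Gz]]] := add_principal_gr homP Gs Gx Ix.
  by rewrite mk in Gz; exists y, z.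
have Ntw : N m t <= w ^+ m.
  apply: le_trans Nt _; rewrite /w exprMn mulrC; apply: ler_pM.
  - exact: ltW.
  - exact/exprn_ge0/ltW.
  - by case: (m) m0 => // j _; rewrite exprS ler_peMr ?exprn_ege1 ?ltW.
  - by rewrite lerXn2r // nnegrE ltW.
have -> : H k = \sum_(i < k) h i + h k by rewrite /H big_ord_recr.
have -> : w ^+ k = w ^+ m * w ^+ (k - m) by rewrite -exprD subnKC.
rewrite mulrDr lerD2r mulrA.
apply: ler_pM => //; first by apply: mulr_ge0 => //; exact/exprn_ge0/ltW.
  by apply: ler_wpM2r => //; exact/exprn_ge0/ltW.
(* Since [m] is positive, [k - m <= k - 1], so [H (k - m)] is at most the sum of the [h i] with
   [i < k]; the term [h k] has paid for the quotient by [s]. *)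
case: (k) mk m0 {IHk D0 DD rk rs} => [|j] mj m0; first by rewrite leqNgt m0 in mj.
by apply: Hmono; rewrite leq_subLR -add1n leq_add2r.
Qed.

(** For a closed subvariety this says that its dimension is less than [e], in a recursive form
    suited to induction on [e]. *)
Fixpoint dim_lt (e : nat) P : Prop :=
  if e is e'.+1 then forall Q, closed_subvariety G Q -> (forall x, P x -> Q x) ->
    (exists x, Q x /\ ~ P x) -> dim_lt e' Q
  else False.

(** Each failure supplies a strictly smaller subvariety, that is, a strictly larger prime; [P]
    itself sits at the last index [e]. *)
Lemma dim_lt_chain e P : closed_subvariety G P -> ~ dim_lt e P ->
  exists Y : nat -> A -> Prop,
    [/\ (forall i, (i <= e)%N -> closed_subvariety G (Y i)), Y e = P &
        forall i, (i < e)%N ->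
          (forall x, Y i.+1 x -> Y i x) /\ exists x, Y i x /\ ~ Y i.+1 x].
Proof.
elim: e P => [|e IHe] P cP; first by exists (fun=> P).
move=> /existsNP[Q] /not_implyP[cQ] /not_implyP[PQ] /not_implyP[nQP nd].
have [Y [cY Ye dec]] := IHe Q cQ nd.
exists (fun i => if (i <= e)%N then Y i else P); split.
- by move=> i _; case: ifP => [/cY|].
- by rewrite ltnn.
- move=> i; rewrite ltnS => ie; rewrite ie.
  case: ifP => [lt|]; first exact: dec.
  move=> /negbT; rewrite -ltnNge ltnS => ei.
  by have -> : i = e by [apply/eqP; rewrite eqn_leq ie]; rewrite Ye.
Qed.

Lemma dim_bound_step e P : closed_subvariety G P ->
  (forall Q, closed_subvariety G Q -> dim_lt e Q -> estimate e Q) ->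
  dim_lt e.+1 P ->
  exists Y (C : R), [/\ closed_subvariety G Y, 0 <= C &
    forall n, reach n (deg P n) (G n) (C * n.+1%:R ^+ e * ups Y ^+ n)].
Proof.
move=> cP IHe dP; apply: prime_bound => // Q pQ PQ QP.
have [rel|irr] := EM (relevant G Q); first by apply: IHe => //; exact: dP.
exact/(estimate_leq (leq0n e))/estimate_irrelevant.
Qed.

(** Passing from a bound in each degree to partial sums costs one factor [n.+1], so each dimension
    raises the exponent by one. *)
Lemma estimate_dim e P : closed_subvariety G P -> dim_lt e P -> estimate e P.
Proof.
elim: e P => // e IHe P cP dP.
have [Y [C [cY C0 r]]] := dim_bound_step cP IHe dP.
exists Y, (fun n => C * n.+1%:R ^+ e), C; split=> // n.
- by rewrite mulr_ge0 ?exprn_ge0.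
- apply: le_trans (_ : \sum_(k < n.+1) C * n.+1%:R ^+ e <= _).
    by apply: ler_sum => k _; rewrite ler_wpM2l // lerXn2r ?nnegrE // ler_nat.
  by rewrite sumr_const card_ord -[X in X <= _]mulr_natr -mulrA -exprSr.
by rewrite mulrC; exact: r.
Qed.

(** At the top the bound is kept degree by degree, since summing would cost a further factor
    [n.+1]. *)
Lemma dim_bound e P : closed_subvariety G P -> dim_lt e.+1 P ->
  exists Y (C : R), [/\ closed_subvariety G Y, 0 <= C &
    forall n, reach n (deg P n) (G n) (C * n.+1%:R ^+ e * ups Y ^+ n)].
Proof. by move=> cP; apply: dim_bound_step => // Q; exact: estimate_dim. Qed.

End Estimates.

End Lattice.

(** * Real norms and successive minima *)

Section RealExtension.
Variables (A : comAlgType rat) (R : realType) (G M : nat -> A -> Prop).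
Variables (V : nat -> normedModType R) (iota : forall n, A -> V n).
Hypothesis grG : is_grading G.
Hypothesis extG : real_ext G iota.

Lemma iotaD n a b : G n a -> G n b -> iota n (a + b) = iota n a + iota n b.
Proof. by case: (extG n) => + _ _ _; apply. Qed.

Lemma iotaZ n (q : rat) a : G n a -> iota n (q *: a) = ratr q *: iota n a.
Proof. by case: (extG n) => _ + _ _; apply. Qed.

Lemma iota_sum n k (e : 'I_k -> A) (q : 'I_k -> rat) : (forall i, G n (e i)) ->
  iota n (\sum_(i < k) q i *: e i) = \sum_(i < k) ratr (q i) *: iota n (e i).
Proof.
elim: k e q => [|k IHk] e q Ge.
  by rewrite !big_ord0 -(scale0r 0) iotaZ ?rmorph0 ?scale0r //; exact: gr0.
rewrite !big_ord_recr /= iotaD ?iotaZ ?IHk //; last exact: grZ.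
by apply: (gr_sum grG) => i; exact: grZ.
Qed.

Lemma ratr_approx (c eps : R) : 0 < eps -> exists q : rat, `|c - ratr q| <= eps.
Proof.
move=> e0; have [|q] := @rat_in_itvoo R c (c + eps); first by rewrite ltrDl.
rewrite in_itv /= => /andP[cq qc]; exists q.
by rewrite ler_norml; apply/andP; split; lra.
Qed.

(** An almost optimal real lift of [s] involves finitely many elements of [Y]; making its
    coefficients rational gives [t] in [G n]. Half of [c' - c] pays for missing the infimum, half
    for the approximation. *)
Lemma quot_norm_lift n (Y : A -> Prop) s (c c' : R) : hom_ideal grG Y -> G n s ->
  quot_norm G iota n Y s <= c -> c < c' ->
  exists t, [/\ G n t, Y (s - t) & `|iota n t| <= c'].
Proof.
move=> [idY _] Gs; rewrite /quot_norm; set E := (X in inf X) => infE cc'.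
have infEP : has_inf E.
  split; last by exists 0 => _ [v [_ ->]].
  exists `|iota n s + 0|, 0; split=> //; exists 0%N, (fun=> 0), (fun=> 0).
  by rewrite big_ord0; split=> // -[].
pose eps := (c' - c) / 2; have eps0 : 0 < eps by rewrite /eps; lra.
have [_ [_ [[k [e [r [eY ->]]]] ->]] lt] := inf_adherent eps0 infEP.
pose B := 1 + \sum_(i < k) `|iota n (e i)|.
have B0 : 0 < B by rewrite ltr_pwDl ?ltr01 ?sumr_ge0.
have [q qr] := choice (fun i => ratr_approx (r i) (divr_gt0 eps0 B0)).
have Ge i : G n (e i) by case: (eY i).
have Gsum : G n (\sum_(i < k) q i *: e i) by apply: (gr_sum grG) => i; exact: grZ.
exists (s + \sum_(i < k) q i *: e i); split; first exact: grD.
  rewrite opprD addrA subrr add0r; apply/(idealN idY)/(ideal_sum idY) => i _.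
  by apply: (idealZ idY); case: (eY i).
rewrite iotaD // iota_sum //.
set v := \sum_(i < k) r i *: _ in lt; set w := \sum_(i < k) _.
have -> : iota n s + w = (iota n s + v) - (v - w) by rewrite opprB addrACA subrr addr0.
apply: le_trans (ler_normB _ _) _.
suff : `|v - w| <= eps by move: lt infE; rewrite /eps; lra.
rewrite /v /w -sumrB; apply: le_trans (ler_norm_sum _ _ _) _.
apply: le_trans (_ : \sum_(i < k) eps / B * `|iota n (e i)| <= _).
  apply: ler_sum => i _; rewrite -scalerBl normrZ.
  exact: ler_wpM2r.
by rewrite -mulr_sumr mulrAC ler_pdivrMr // ler_pM2l // lerDr.
Qed.

Lemma lambdaQ_le n (l : R) : 0 <= l ->
  (exists k (e : 'I_k -> A),
    [/\ forall i, M n (e i), Qfree e,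
        forall x, G n x -> Qspan (fun y => exists i, y = e i) x
      & forall i, `|iota n (e i)| <= l]) ->
  lambdaQ G M iota n <= l.
Proof.
move=> l0 basis; rewrite /lambdaQ; case: ifP => // _.
by apply: ge_inf => //; exists 0 => x [].
Qed.

End RealExtension.

(** * The zero ideal and the final bound *)

Lemma zero_hom_prime (A : comAlgType rat) (G : nat -> A -> Prop) :
  is_grading G -> (forall a b : A, a * b = 0 -> a = 0 \/ b = 0) ->
  hom_prime G (eq^~ 0).
Proof.
move=> grG dom; split=> //.
- by split=> // x y -> ->; rewrite addr0.
- by move=> r x ->; rewrite mulr0.
- by apply/eqP; exact: oner_neq0.
- by case: grG.
Qed.

Lemma zero_dim_lt (A : comAlgType rat) (G : nat -> A -> Prop) d :
  closed_subvariety G (eq^~ 0) -> ~ subvar_chain G d -> dim_lt G d (eq^~ 0).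
Proof.
move=> cX nchain; apply: contrapT => nd; apply: nchain.
by have [Y [cY _ dec]] := dim_lt_chain cX nd; exists Y.
Qed.

Lemma succ_expn_le (R : realType) n d e : (0 < n)%N -> (d <= e)%N ->
  n.+1%:R ^+ d <= 2 ^+ d * n%:R ^+ e :> R.
Proof.
move=> n0 de; apply: le_trans (_ : (2 * n%:R) ^+ d <= _).
  by rewrite lerXn2r ?nnegrE // -natrM ler_nat; lia.
rewrite exprMn ler_pM2l ?exprn_gt0 //.
by rewrite ler_weXn2l // ler1n.
Qed.

Unset Implicit Arguments.

Theorem theorem5p4 (A : comAlgType rat) (R : realType) (G M : nat -> A -> Prop)
    (V : nat -> normedModType R) (iota : forall n, A -> V n)
    (upsilon : (A -> Prop) -> R) (d : nat) :
  is_grading G ->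
  finite_type A ->
  (forall n, Qfindim (G n)) ->
  (forall a b : A, a * b = 0 -> a = 0 \/ b = 0) ->
  is_integral_structure G M ->
  real_ext G iota ->
  (forall n n' a b, M n a -> M n' b ->
     `|iota (n + n')%N (a * b)| <= `|iota n a| * `|iota n' b|) ->
  proj_dim G d ->
  (forall Y, closed_subvariety G Y ->
     0 < upsilon Y /\
     exists n a, [/\ (1 <= n)%N, M n a, ~ Y a & quot_norm G iota n Y a <= upsilon Y ^+ n]) ->
  exists B : R, 0 < B /\
  exists k (S : 'I_k -> (A -> Prop)),
    (forall i, closed_subvariety G (S i)) /\
    forall n, (1 <= n)%N ->
      lambdaQ G M iota n <=
        B * n%:R ^+ ((d * (d + 1)) %/ 2) * (\big[Num.max/0]_(i < k) upsilon (S i)) ^+ n.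
Proof.
move=> grG ftA findim dom intM extG NM_int [chain nchain] small.
have ups_gt0 Y : closed_subvariety G Y -> 0 < upsilon Y by move=> /small[].
have cX : closed_subvariety G (eq^~ 0).
  split; first exact: zero_hom_prime.
  (* An element outside the prime [Y 0] is nonzero, because the prime contains 0; hence the zero
     ideal is relevant. *)
  have [Y [cY _]] := chain; have [[[Y0 _] _ _ _ _] [n [a [n0 [Ga nYa]]]]] := cY 0%N isT.
  by exists n, a; split=> //; split=> // a0; apply: nYa; rewrite a0.
pose N n x := `|iota n x|.
have ND n x y : G n x -> G n y -> N n (x + y) <= N n x + N n y.
  by move=> Gx Gy; rewrite /N (iotaD extG) // ler_normD.
have NZ n (q : rat) x : G n x -> N n (q *: x) = `|ratr q| * N n x.
  by move=> Gx; rewrite /N (iotaZ extG) // normrZ.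
have N_ge0 n x : 0 <= N n x by exact: normr_ge0.
have smallN Y : closed_subvariety G Y -> exists m s, [/\ (0 < m)%N, M m s, ~ Y s &
    forall q, 1 < q -> exists t, [/\ G m t, Y (s - t) & N m t <= upsilon Y ^+ m * q]].
  move=> cY; have [u0 [m [s [m1 Ms nYs le]]]] := small Y cY.
  exists m, s; split=> // q q1; have [pY _] := cY.
  apply: (quot_norm_lift extG (hom_prime_ideal grG pY) _ le).
    exact: (lat_gr intM Ms).
  by rewrite ltr_pMr // exprn_gt0.
have [Y [C [cY C0 r]]] := dim_bound grG intM N_ge0 NZ NM_int
  (@finite_type_acc _ ftA) ups_gt0 smallN (ex_intro _ _ cX) cX (zero_dim_lt cX nchain).
have u0 := ups_gt0 Y cY.
(* The factor [2 ^+ d] comes from [n.+1 <= 2 * n]; the summand 1 makes the constant positive even if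
   [C] is 0. *)
exists (C * 2 ^+ d + 1); split.
  by rewrite ltr_wpDl // mulr_ge0 // exprn_ge0.
(* For a singleton the maximum with default 0 is [upsilon Y], which is positive. *)
exists 1%N, (fun=> Y); split=> // n n1.
rewrite big_ord_recl big_ord0 (max_l (ltW u0)).
have [|T0 basis] := reach_basis grG intM N_ge0 ND NZ (n := n)
  (T := C * n.+1%:R ^+ d * upsilon Y ^+ n).
  apply: reach_base (r n) => // [x y -> ->|x []//]; exact: addr0.
apply: le_trans (lambdaQ_le T0 basis) _.
apply: ler_wpM2r; first exact/exprn_ge0/ltW.
rewrite mulrDl mul1r -mulrA; apply: ler_wpDr; first exact: exprn_ge0.
apply: ler_wpM2l => //; apply: succ_expn_le => //.
(* [d * 2 <= d * (d + 1)]: both sides vanish for [d = 0], and [d + 1 >= 2] otherwise. *)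
by rewrite leq_divRL //; case: (d) => // d'; nia.
Qed.
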